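(* Let $X, Y$ be Banach spaces, let $T\in C(X,Y)$, and let $T^+\in D(Y,X)$ be a generalized inverse of $T$. Let $\delta T\colon D(\delta T)\to D(T^+)$ be a linear operator, with $D(\delta T)\subset X$ a linear subspace, such that $D(T)\subset D(\delta T)$. Assume that $\delta T$ is $T$-bounded with constants $a,b>0$, where $b<1$, and that $I_Y+\delta T\,T^+\colon D(T^+)\to D(T^+)$ is bijective. Put $\bar T=T+\delta T$ and $G=T^+(I_Y+\delta T\,T^+)^{-1}$ (with domain $D(T^+)$). Then: (A) The following conditions are equivalent: (1) $R(\bar T)\cap N(T^+)=\{0\}$; (2) $G\in D(Y,X)$ is a generalized inverse of $\bar T$, with $R(G)=R(T^+)$ and $N(G)=N(T^+)$; (3) $(I_Y+\delta T\,T^+)^{-1}\bar T$ maps $N(T)$ into $R(T)$; (4) $(I_Y+\delta T\,T^+)^{-1}R(\bar T)=R(T)$; (5) $(I_X+T^+\delta T)^{-1}N(T)=N(\bar T)$. (B) Assume further that $\delta T\in C(X,Y)$, that $T^+\in C(Y,X)$, and that $$c=\sup\{\|TT^+x\| : x\in D(T^+),\ \|x\|=1\}<+\infty .$$ If $bc<1$, then $G\in C(Y,X)$.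
   Context: Operators are linear and may be unbounded; $D(A)$, $R(A)$, $N(A)$ denote the domain, range and null space of an operator $A$, and $I_X$, $I_Y$ are identity operators. $D(X,Y)$ denotes the set of densely defined linear operators from $X$ to $Y$ (domain a dense linear subspace of $X$), and $C(X,Y)$ the set of closed densely defined linear operators from $X$ to $Y$. For $T\in C(X,Y)$, a generalized inverse of $T$, denoted $T^+$, is an operator $S\in D(Y,X)$ with $D(S)\supset R(T)$, $R(S)\subset D(T)$, $TST=T$ on $D(T)$ and $STS=S$ on $D(S)$. The operator $\delta T$ with $D(T)\subset D(\delta T)$ is $T$-bounded with constants $a,b>0$ if $\|\delta T x\|\le a\|x\|+b\|Tx\|$ for all $x\in D(T)$. The operator $\bar T=T+\delta T$ has domain $D(T)$; when $\delta T$ is $T$-bounded with $b<1$ it is known that $\bar T\in C(X,Y)$. In (5), $(I_X+T^+\delta T)^{-1}$ is the inverse of the map $I_X+T^+\delta T\colon D(T)\to D(T)$, which is bijective because $I_Y+\delta T\,T^+\colon D(T^+)\to D(T^+)$ is. *)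

(* Defs.v *)
From Stdlib Require Import Reals Ensembles ClassicalEpsilon.
From Coquelicot Require Import Coquelicot.

Set Implicit Arguments.
Unset Strict Implicit.
Unset Printing Implicit Defensive.

Local Open Scope R_scope.

Section Operators.

Variable K : AbsRing.

(* A partially defined map.  The values of [app] outside [dom] are junk: no
   definition below depends on them. *)
Record op (X Y : NormedModule K) : Type := Op {
  dom : X -> Prop;
  app :> X -> Y
}.

Definition linear_subspace (X : NormedModule K) (D : X -> Prop) : Prop :=
  D zero /\
  (forall x y : X, D x -> D y -> D (plus x y)) /\
  (forall (l : K) (x : X), D x -> D (scal l x)).

Definition dense (X : NormedModule K) (D : X -> Prop) : Prop :=
  forall (x : X) (U : X -> Prop), locally x U -> exists y : X, U y /\ D y.

Definition linear_op (X Y : NormedModule K) (A : op X Y) : Prop :=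
  linear_subspace (dom A) /\
  (forall x y : X, dom A x -> dom A y -> A (plus x y) = plus (A x) (A y)) /\
  (forall (l : K) (x : X), dom A x -> A (scal l x) = scal l (A x)).

Definition ran (X Y : NormedModule K) (A : op X Y) : Y -> Prop :=
  fun y => exists x : X, dom A x /\ A x = y.

Definition ker (X Y : NormedModule K) (A : op X Y) : X -> Prop :=
  fun x => dom A x /\ A x = zero.

Definition op_image (X Y : NormedModule K) (A : op X Y) (S : X -> Prop) :
    Y -> Prop :=
  fun y => exists x : X, dom A x /\ S x /\ A x = y.

Definition op_maps (X Y : NormedModule K) (A : op X Y)
    (S : X -> Prop) (U : Y -> Prop) : Prop :=
  forall x : X, S x -> dom A x /\ U (A x).

(* [A : D -> E], with [D] the whole domain of [A], is a bijection. *)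
Definition op_bijective (X Y : NormedModule K) (A : op X Y)
    (D : X -> Prop) (E : Y -> Prop) : Prop :=
  Same_set _ (dom A) D /\
  op_maps A D E /\
  (forall x x' : X, D x -> D x' -> A x = A x' -> x = x') /\
  (forall y : Y, E y -> exists x : X, D x /\ A x = y).

(* The class D(X,Y). *)
Definition densely_defined_op (X Y : NormedModule K) (A : op X Y) : Prop :=
  linear_op A /\ dense (dom A).

(* The class C(X,Y). *)
Definition closed_op (X Y : NormedModule K) (A : op X Y) : Prop :=
  densely_defined_op A /\
  closed (fun p : X * Y => dom A (fst p) /\ A (fst p) = snd p).

Definition op_id (X : NormedModule K) : op X X :=
  Op (fun _ : X => True) (fun x : X => x).

Definition op_add (X Y : NormedModule K) (A B : op X Y) : op X Y :=
  Op (fun x => dom A x /\ dom B x) (fun x => plus (A x) (B x)).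

Definition op_comp (X Y Z : NormedModule K) (B : op Y Z) (A : op X Y) :
    op X Z :=
  Op (fun x => dom A x /\ dom B (A x)) (fun x => B (A x)).

Definition op_restrict (X Y : NormedModule K) (A : op X Y) (D : X -> Prop) :
    op X Y :=
  Op (fun x => dom A x /\ D x) (app A).

(* Meaningful when [A] is injective on its domain. *)
Definition op_inv (X Y : NormedModule K) (A : op X Y) : op Y X :=
  Op (ran A)
     (fun y => epsilon (inhabits (zero : X)) (fun x => dom A x /\ A x = y)).

Definition generalized_inverse (X Y : NormedModule K)
    (T : op X Y) (S : op Y X) : Prop :=
  densely_defined_op S /\
  Included _ (ran T) (dom S) /\
  Included _ (ran S) (dom T) /\
  (forall x : X, dom T x -> T (S (T x)) = T x) /\
  (forall y : Y, dom S y -> S (T (S y)) = S y).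

Definition relatively_bounded (X Y : NormedModule K)
    (dT T : op X Y) (a b : R) : Prop :=
  Included _ (dom T) (dom dT) /\ 0 < a /\ 0 < b /\
  (forall x : X, dom T x -> norm (dT x) <= a * norm x + b * norm (T x)).

(* The supremum over the unit sphere of the domain of [A]; it is -oo when the
   domain is {0}. *)
Definition op_sup (X Y : NormedModule K) (A : op X Y) : Rbar :=
  Lub_Rbar (fun r => exists x : X, dom A x /\ norm x = 1 /\ r = norm (A x)).

End Operators.

Arguments op_id {K} X.

(* Main.v *)
(* Write W = I + dT Tp, J = W^-1 and Tbar = T + dT.  Everything rests on
   W y = (y - T Tp y) + Tbar (Tp y), where y - T Tp y lies in N(Tp): thus W is the
   identity on N(Tp) and equals Tbar Tp on R(T).  Hence G Tbar G = G, R(G) = R(Tp)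
   and N(G) = N(Tp) always hold, and each of the five conditions says that J maps
   R(Tbar) into R(T).
   For closedness, let y_n -> y with G y_n -> x and put z_n = J y_n, so that
   dT (G y_n) = y_n - z_n.  The relative bound together with b c < 1 makes
   dT (G y_n) a Cauchy sequence; closedness of dT and then of Tp identifies the
   limits of dT (G y_n) and of z_n, giving y = W z and x = G y. *)
Require Import Defs.
From Stdlib Require Import Reals Ensembles.
From Coquelicot Require Import Coquelicot.
From Stdlib Require Import ClassicalEpsilon Classical Lra.
Local Open Scope R_scope.

(** * Limits of pairs, additive identities and norm estimates *)

Lemma filterlim_pair_locally {S : Type} {U V : UniformSpace} {F : (S -> Prop) -> Prop}
    {FF : Filter F} (f : S -> U) (g : S -> V) (u : U) (v : V) :
  filterlim f F (locally u) -> filterlim g F (locally v) ->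
  filterlim (fun s => (f s, g s)) F (locally (u, v)).
Proof.
intros hf hg; apply filterlim_locally; intros eps.
apply filter_and; [exact (proj1 (filterlim_locally f u) hf eps)
  | exact (proj1 (filterlim_locally g v) hg eps)].
Qed.

Section NormedModules.

Context {K : AbsRing} {G : NormedModule K}.

Lemma minus_add (x y : G) : plus (minus x y) y = x.
Proof.
etransitivity; [exact (eq_sym (plus_assoc x (opp y) y))|].
etransitivity; [exact (f_equal (plus x) (plus_opp_l y))|].
exact (plus_zero_r x).
Qed.

Lemma add_minus (x y : G) : minus (plus x y) y = x.
Proof.
etransitivity; [exact (eq_sym (plus_assoc x y (opp y)))|].
etransitivity; [exact (f_equal (plus x) (plus_opp_r y))|].
exact (plus_zero_r x).
Qed.

Lemma add_minus_l (x y : G) : minus (plus x y) x = y.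
Proof. rewrite (plus_comm x y); apply add_minus. Qed.

Lemma minus_zero_eq (x y : G) : minus x y = zero -> x = y.
Proof.
intros H; rewrite <- (minus_add x y), H; exact (plus_zero_l y).
Qed.

Lemma plus_plus_comm (x y u v : G) :
  plus (plus x y) (plus u v) = plus (plus x u) (plus y v).
Proof.
rewrite <- !plus_assoc; f_equal.
rewrite !plus_assoc; f_equal; apply plus_comm.
Qed.

Lemma minus_plus_plus (x y u v : G) :
  minus (plus x y) (plus u v) = plus (minus x u) (minus y v).
Proof.
etransitivity; [exact (f_equal (plus (plus x y)) (opp_plus u v))|].
exact (plus_plus_comm x y (opp u) (opp v)).
Qed.

Lemma minus_minus_minus (x y u v : G) :
  minus (minus x y) (minus u v) = minus (minus x u) (minus y v).
Proof.
etransitivity; [exact (minus_plus_plus x (opp y) u (opp v))|].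
exact (f_equal (plus (minus x u)) (eq_sym (opp_plus y (opp v)))).
Qed.

(** Balls and norms are comparable only up to [norm_factor], which therefore enters the choice of
    radii in the Cauchy argument. *)
Lemma norm_minus_half_balls (x y z : G) (e : posreal) :
  ball x (e / 2) y -> ball x (e / 2) z -> norm (minus z y) < norm_factor (V := G) * e.
Proof.
intros hy hz; apply norm_compat2; rewrite <- (Rplus_half_diag e).
apply ball_triangle with x; [now apply ball_sym | exact hz].
Qed.

End NormedModules.

(** * Algebra of partially defined linear operators *)

Section LinearOperators.

Context {K : AbsRing}.

Lemma linear_dom_plus {X Y : NormedModule K} {A : op X Y} (hA : linear_op A) {x y : X} :
  dom A x -> dom A y -> dom A (plus x y).
Proof. apply hA. Qed.

Lemma linear_dom_scal {X Y : NormedModule K} {A : op X Y} (hA : linear_op A) (l : K) {x : X} :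
  dom A x -> dom A (scal l x).
Proof. apply hA. Qed.

Lemma linear_dom_minus {X Y : NormedModule K} {A : op X Y} (hA : linear_op A) {x y : X} :
  dom A x -> dom A y -> dom A (minus x y).
Proof.
intros hx hy; apply (linear_dom_plus hA hx).
exact (eq_ind _ (dom A) (linear_dom_scal hA (opp one) hy) _ (scal_opp_one y)).
Qed.

Lemma linear_plus {X Y : NormedModule K} {A : op X Y} (hA : linear_op A) {x y : X} :
  dom A x -> dom A y -> A (plus x y) = plus (A x) (A y).
Proof. apply hA. Qed.

Lemma linear_scal {X Y : NormedModule K} {A : op X Y} (hA : linear_op A) (l : K) {x : X} :
  dom A x -> A (scal l x) = scal l (A x).
Proof. apply hA. Qed.

Lemma linear_minus {X Y : NormedModule K} {A : op X Y} (hA : linear_op A) {x y : X} :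
  dom A x -> dom A y -> A (minus x y) = minus (A x) (A y).
Proof.
intros hx hy.
transitivity (A (plus x (scal (opp one) y))).
- now rewrite (scal_opp_one y).
- rewrite (linear_plus hA), (linear_scal hA); auto using linear_dom_scal.
  now rewrite (scal_opp_one (A y)).
Qed.

Lemma linear_zero {X Y : NormedModule K} {A : op X Y} (hA : linear_op A) : A zero = zero.
Proof.
assert (h0 : dom A zero) by apply hA.
transitivity (A (minus zero zero)).
- apply f_equal; symmetry; exact (minus_eq_zero zero).
- exact (eq_trans (linear_minus hA h0 h0) (minus_eq_zero _)).
Qed.

Lemma linear_op_id (X : NormedModule K) : linear_op (op_id X).
Proof. repeat split. Qed.

Lemma linear_op_add {X Y : NormedModule K} {A B : op X Y} :
  linear_op A -> linear_op B -> linear_op (op_add A B).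
Proof.
intros hA hB; repeat split; simpl.
- apply hA.
- apply hB.
- apply (linear_dom_plus hA); firstorder.
- apply (linear_dom_plus hB); firstorder.
- apply (linear_dom_scal hA); firstorder.
- apply (linear_dom_scal hB); firstorder.
- intros x y [hxA hxB] [hyA hyB].
  rewrite (linear_plus hA hxA hyA), (linear_plus hB hxB hyB).
  apply plus_plus_comm.
- intros l x [hxA hxB].
  rewrite (linear_scal hA l hxA), (linear_scal hB l hxB).
  symmetry; apply (scal_distr_l (V := Y)).
Qed.

Lemma linear_op_comp {X Y Z : NormedModule K} {B : op Y Z} {A : op X Y} :
  linear_op A -> linear_op B -> linear_op (op_comp B A).
Proof.
intros hA hB; repeat split; simpl.
- apply hA.
- rewrite (linear_zero hA); apply hB.
- apply (linear_dom_plus hA); firstorder.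
- rewrite (linear_plus hA); firstorder.
- apply (linear_dom_scal hA); firstorder.
- rewrite (linear_scal hA); firstorder.
- intros x y [hxA hxB] [hyA hyB].
  now rewrite (linear_plus hA hxA hyA), (linear_plus hB hxB hyB).
- intros l x [hxA hxB].
  now rewrite (linear_scal hA l hxA), (linear_scal hB l hxB).
Qed.

(** On the range a preimage exists, so the [epsilon] choice is a genuine one; every later fact about
    [op_inv] starts here. *)
Lemma ran_op_inv_spec {X Y : NormedModule K} (A : op X Y) {y : Y} :
  ran A y -> dom A (op_inv A y) /\ A (op_inv A y) = y.
Proof.
intros hy; unfold op_inv; simpl.
exact (epsilon_spec (inhabits (zero : X)) (fun x => dom A x /\ A x = y) hy).
Qed.

(** * Inverses of bijective operators *)

Section Bijective.

Context {X Y : NormedModule K} {A : op X Y} {D : X -> Prop} {E : Y -> Prop}.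
Hypothesis hA : op_bijective A D E.

Lemma bijective_dom (x : X) : dom A x <-> D x.
Proof. split; apply hA. Qed.

Lemma bijective_ran (y : Y) : ran A y <-> E y.
Proof.
destruct hA as [hD [hm [_ hs]]]; split.
- intros [x [hx <-]]; apply hm; now apply hD.
- intros hy; destruct (hs y hy) as [x [hx <-]].
  exists x; split; [now apply hD | reflexivity].
Qed.

Lemma bijective_inv_dom (y : Y) : E y -> D (op_inv A y).
Proof.
intros hy; apply bijective_dom, ran_op_inv_spec; now apply bijective_ran.
Qed.

Lemma bijective_inv_r (y : Y) : E y -> A (op_inv A y) = y.
Proof.
intros hy; apply ran_op_inv_spec; now apply bijective_ran.
Qed.

Lemma bijective_inv_l (x : X) : D x -> op_inv A (A x) = x.
Proof.
intros hx; assert (hy : E (A x)) by now apply hA.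
apply hA; auto using bijective_inv_dom, bijective_inv_r.
Qed.

Lemma bijective_inv_unique (x : X) (y : Y) : D x -> A x = y -> op_inv A y = x.
Proof. intros hx <-; now apply bijective_inv_l. Qed.

(** Sums and multiples of chosen preimages are preimages of the sums and multiples; injectivity
    makes them the chosen ones. *)
Lemma linear_op_inv : linear_op A -> linear_op (op_inv A).
Proof.
intros hl.
assert (h : forall y, ran A y -> dom A (op_inv A y) /\ A (op_inv A y) = y)
  by (intros y; apply ran_op_inv_spec).
assert (hp : forall x y, ran A x -> ran A y ->
  dom A (plus (op_inv A x) (op_inv A y)) /\
  A (plus (op_inv A x) (op_inv A y)) = plus x y).
{ intros x y hx hy; destruct (h x hx) as [dx ex], (h y hy) as [dy ey].
  split; [now apply (linear_dom_plus hl)|].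
  now rewrite (linear_plus hl), ex, ey. }
assert (hs : forall l x, ran A x ->
  dom A (scal l (op_inv A x)) /\ A (scal l (op_inv A x)) = scal l x).
{ intros l x hx; destruct (h x hx) as [dx ex].
  split; [now apply (linear_dom_scal hl)|].
  now rewrite (linear_scal hl), ex. }
split; [split; [|split]|split]; simpl.
- exists zero; split; [apply hl | apply (linear_zero hl)].
- intros x y hx hy; eexists; now apply hp.
- intros l x hx; eexists; now apply hs.
- intros x y hx hy; destruct (hp x y hx hy).
  apply bijective_inv_unique; [now apply bijective_dom | assumption].
- intros l x hx; destruct (hs l x hx).
  apply bijective_inv_unique; [now apply bijective_dom | assumption].
Qed.

End Bijective.

(** Serves to normalize a vector. The absolute value of an [AbsRing] is only submultiplicative, so
    those of [l] and of its inverse [l'] are both recorded. *)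
Lemma exists_scalar_abs (hK : K = R_AbsRing \/ K = C_AbsRing) (r : R) : 0 < r ->
  exists l l' : K, mult l' l = one /\ abs l = / r /\ abs l' = r.
Proof.
intros hr; destruct hK as [-> | ->].
- exists (/ r), r; change (r * / r = 1 /\ Rabs (/ r) = / r /\ Rabs r = r).
  rewrite !Rabs_pos_eq; [repeat split | | apply Rlt_le, Rinv_0_lt_compat]; try lra.
  field; lra.
- exists (RtoC (/ r)), (RtoC r).
  change (Cmult (RtoC r) (RtoC (/ r)) = RtoC 1 /\
    Cmod (RtoC (/ r)) = / r /\ Cmod (RtoC r) = r).
  rewrite !Cmod_R, !Rabs_pos_eq; try lra.
  2: apply Rlt_le, Rinv_0_lt_compat; lra.
  repeat split; rewrite <- RtoC_mult; f_equal; field; lra.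
Qed.

(* [Rmax 0] covers the junk value of [real] at [-oo], taken when the domain
   is trivial. *)
Lemma op_sup_bound (hK : K = R_AbsRing \/ K = C_AbsRing)
    {X Y : NormedModule K} {A : op X Y} (hA : linear_op A) :
  Rbar_lt (op_sup A) p_infty ->
  forall x, dom A x -> norm (A x) <= Rmax 0 (op_sup A) * norm x.
Proof.
intros hc x hx.
destruct (norm_ge_0 x) as [hr | h0].
2: { rewrite (norm_eq_zero x (eq_sym h0)), (linear_zero hA), !norm_zero; lra. }
destruct (exists_scalar_abs hK (norm x) hr) as (l & l' & hll & hl & hl').
assert (hx' : x = scal l' (scal l x)) by now rewrite scal_assoc, hll, scal_one.
assert (hlx := linear_dom_scal hA l hx).
(* [norm_scal] is an inequality: used with [l] it gives [<= 1], used with [l'] to scale back to [x]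
   it gives [>= 1]. *)
assert (hn1 : norm (scal l x) = 1).
{ apply Rle_antisym.
  - eapply Rle_trans; [apply norm_scal|]; rewrite hl, Rinv_l; lra.
  - apply (Rmult_le_reg_l (norm x)); [exact hr|].
    rewrite Rmult_1_r; generalize (norm_scal l' (scal l x)).
    now rewrite <- hx', hl'. }
assert (hs : Rbar_le (norm (A (scal l x))) (op_sup A)).
{ apply (proj1 (Lub_Rbar_correct _)); now exists (scal l x). }
rewrite hx' at 1; rewrite (linear_scal hA l' hlx).
eapply Rle_trans; [apply norm_scal|].
rewrite hl', Rmult_comm; apply Rmult_le_compat_r; [lra|].
destruct (op_sup A) as [c | |]; simpl in *; try easy.
eapply Rle_trans; [exact hs | apply Rmax_r].
Qed.

End LinearOperators.

(** * Algebra of the perturbed operator and of its candidate inverse *)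

Section PerturbedInverse.

Context {K : AbsRing} {X Y : NormedModule K}.
Context {T dT : op X Y} {Tp : op Y X}.

Hypothesis linT : linear_op T.
Hypothesis linD : linear_op dT.
Hypothesis hTp : generalized_inverse T Tp.
Hypothesis hran : op_maps dT (dom dT) (dom Tp).
Hypothesis hdom : Included X (dom T) (dom dT).

Notation Tbar := (op_add T dT).
Notation W := (op_add (op_id Y) (op_comp dT Tp)).
Notation J := (op_inv W).
Notation V := (op_restrict (op_add (op_id X) (op_comp Tp dT)) (dom T)).
Notation J' := (op_inv V).
Notation G := (op_comp Tp J).

Hypothesis hW : op_bijective W (dom Tp) (dom Tp).

Lemma gi_linear : linear_op Tp.
Proof. apply hTp. Qed.

Lemma gi_ran_sub (x : X) : dom T x -> dom Tp (T x).
Proof. intros hx; apply hTp; now exists x. Qed.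

Lemma gi_dom (y : Y) : dom Tp y -> dom T (Tp y).
Proof. intros hy; apply hTp; now exists y. Qed.

Lemma gi_ran (y : Y) : ran T y -> dom Tp y /\ T (Tp y) = y.
Proof.
intros [x [hx <-]]; split; [now apply gi_ran_sub | now apply hTp].
Qed.

(** Since [Tp T Tp = Tp], the operator [I - T Tp] is the projection of [dom Tp] onto the null space
    of [Tp]. *)
Lemma gi_compl_ker (y : Y) : dom Tp y -> ker Tp (minus y (T (Tp y))).
Proof.
intros hy; assert (hy' := gi_ran_sub _ (gi_dom _ hy)); split.
- now apply (linear_dom_minus gi_linear).
- rewrite (linear_minus gi_linear) by assumption.
  replace (Tp (T (Tp y))) with (Tp y) by (symmetry; now apply hTp).
  exact (minus_eq_zero _).
Qed.

(** Dual projection, from [T Tp T = T]. *)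
Lemma gi_ker_compl (x : X) : dom T x -> ker T (minus x (Tp (T x))).
Proof.
intros hx; assert (hx' := gi_dom _ (gi_ran_sub _ hx)); split.
- now apply (linear_dom_minus linT).
- rewrite (linear_minus linT) by assumption.
  replace (T (Tp (T x))) with (T x) by (symmetry; now apply hTp).
  exact (minus_eq_zero _).
Qed.

Lemma delta_dom (x : X) : dom T x -> dom Tp (dT x).
Proof. intros hx; now apply hran, hdom. Qed.

Lemma Tbar_dom (x : X) : dom Tbar x <-> dom T x.
Proof. split; [now intros [hx _] | intros hx; split; auto; now apply hdom]. Qed.

Lemma Tbar_linear : linear_op Tbar.
Proof. now apply linear_op_add. Qed.

Lemma ran_Tbar_sub (y : Y) : ran Tbar y -> dom Tp y.
Proof.
intros [x [[hx _] <-]]; apply (linear_dom_plus gi_linear).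
- now apply gi_ran_sub.
- now apply delta_dom.
Qed.

Lemma W_linear : linear_op W.
Proof.
apply linear_op_add; [apply linear_op_id | apply linear_op_comp; auto].
apply gi_linear.
Qed.

Lemma J_linear : linear_op J.
Proof. exact (linear_op_inv hW W_linear). Qed.

Lemma J_dom (y : Y) : dom J y <-> dom Tp y.
Proof. exact (bijective_ran hW y). Qed.

Lemma J_maps (y : Y) : dom Tp y -> dom Tp (J y).
Proof. exact (bijective_inv_dom hW y). Qed.

Lemma W_J (y : Y) : dom Tp y -> W (J y) = y.
Proof. exact (bijective_inv_r hW y). Qed.

Lemma J_W (y : Y) : dom Tp y -> J (W y) = y.
Proof. exact (bijective_inv_l hW y). Qed.

Lemma W_ker (y : Y) : ker Tp y -> W y = y.
Proof.
intros [_ h]; simpl; rewrite h, (linear_zero linD); exact (plus_zero_r y).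
Qed.

Lemma J_ker (y : Y) : ker Tp y -> J y = y.
Proof.
intros h; rewrite <- (W_ker _ h) at 1; now apply J_W, h.
Qed.

Lemma W_decomp (y : Y) : W y = plus (minus y (T (Tp y))) (Tbar (Tp y)).
Proof.
simpl; rewrite plus_assoc; f_equal; symmetry; apply minus_add.
Qed.

Lemma Tbar_Tp_ran (y : Y) : ran T y -> Tbar (Tp y) = W y.
Proof.
intros hy; rewrite W_decomp; destruct (gi_ran _ hy) as [_ ->].
rewrite (minus_eq_zero y : minus y y = zero); symmetry; exact (plus_zero_l _).
Qed.

(** Converse of [Tbar_Tp_ran]: by [W_decomp] the difference of the two sides is [y - T (Tp y)], so
    equality forces [y = T (Tp y)]. *)
Lemma ran_of_Tbar_Tp (y : Y) : dom Tp y -> Tbar (Tp y) = W y -> ran T y.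
Proof.
intros hy h; exists (Tp y); split; [now apply gi_dom|].
symmetry; apply minus_zero_eq.
rewrite <- (add_minus (minus y (T (Tp y))) (Tbar (Tp y))), <- W_decomp, h.
exact (minus_eq_zero _).
Qed.

(** * The map [V = I + Tp dT] on the domain of [T] *)

Lemma V_dom (x : X) : dom V x <-> dom T x.
Proof.
split; [now intros [_ hx] | intros hx].
repeat split; auto; [now apply hdom | now apply delta_dom].
Qed.

(* The inverse of [V] is [I - Tp J dT]. *)
Lemma V_bijective : op_bijective V (dom T) (dom T).
Proof.
split; [|split; [|split]].
- split; intros x; apply V_dom.
- intros x hx; split; [now apply V_dom|].
  apply (linear_dom_plus linT hx); now apply gi_dom, delta_dom.
- intros x x' hx hx' h.
  (* Applying [dT] to [V x] gives [W (dT x)], so injectivity of [W] passes to [V]: first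
     [dT x = dT x'], then the terms [Tp (dT x)] cancel. *)
  assert (hd : dT x = dT x').
  { apply (proj1 (proj2 (proj2 hW))); try now apply delta_dom.
    assert (hp : forall u, dom T u -> dom dT u /\ dom dT (Tp (dT u)))
      by (intros u hu; split; [now apply hdom | now apply hdom, gi_dom, delta_dom]).
    generalize (f_equal dT h); simpl; now rewrite !(linear_plus linD) by now apply hp. }
  rewrite <- (add_minus x (Tp (dT x))), <- (add_minus x' (Tp (dT x'))).
  rewrite hd at 2; exact (f_equal (fun u => minus u (Tp (dT x'))) h).
- intros x hx; set (z := J (dT x)).
  assert (hz : dom Tp z) by now apply J_maps, delta_dom.
  assert (hWz : W z = dT x) by now apply W_J, delta_dom.
  exists (minus x (Tp z)); split.
  + apply (linear_dom_minus linT hx); now apply gi_dom.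
  (* As [dT x = W z = z + dT (Tp z)], [dT] sends the witness [x - Tp z] to [z]. *)
  + simpl; rewrite (linear_minus linD) by (apply hdom; (exact hx || now apply gi_dom)).
    rewrite <- hWz; simpl; rewrite add_minus; apply minus_add.
Qed.

(** The hypothesis says [Tp (dT x) = - Tp (T x)]. Thus [V] sends such an [x] into the null space of
    [T], which links [ker Tbar] to [ker T]. *)
Lemma V_eq_compl (x : X) : dom T x -> Tp (Tbar x) = zero ->
  V x = minus x (Tp (T x)).
Proof.
intros hx h; simpl in h.
rewrite (linear_plus gi_linear) in h by (auto using gi_ran_sub, delta_dom).
simpl; rewrite <- (add_minus_l (Tp (T x)) (Tp (dT x))), h.
transitivity (plus x (minus zero (Tp (T x)))); [reflexivity|].
apply (f_equal (plus x)); exact (plus_zero_l _).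
Qed.

(** This half of [P5] is unconditional: [Tbar x = 0] gives [V x = x - Tp (T x)], an element of
    [ker T]. *)
Lemma ker_Tbar_sub : Included X (ker Tbar) (op_image J' (ker T)).
Proof.
intros x [hx h]; apply Tbar_dom in hx.
assert (hV : V x = minus x (Tp (T x))).
{ apply V_eq_compl; auto; rewrite h; apply (linear_zero gi_linear). }
exists (V x); split; [|split].
- exists x; split; [now apply V_dom | reflexivity].
- rewrite hV; now apply gi_ker_compl.
- now apply (bijective_inv_l V_bijective).
Qed.

(** Split [x] as [(x - Tp (T x)) + Tp (T x)]. On the second summand [Tbar Tp] agrees with [W], which
    [J] undoes. What remains depends only on an element of [ker T]. *)
Lemma J_Tbar_decomp (x : X) : dom T x ->
  J (Tbar x) = plus (J (Tbar (minus x (Tp (T x))))) (T x).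
Proof.
intros hx.
assert (hTx : dom Tp (T x)) by now apply gi_ran_sub.
assert (hr : ran T (T x)) by now exists x.
assert (hb : forall u, dom T u -> dom J (Tbar u)).
{ intros u hu; apply J_dom, ran_Tbar_sub; exists u; split; auto.
  now apply Tbar_dom. }
assert (hp := gi_dom _ hTx).
rewrite (linear_minus Tbar_linear) by now apply Tbar_dom.
rewrite (linear_minus J_linear) by now apply hb.
rewrite (Tbar_Tp_ran _ hr), (J_W _ hTx); symmetry; apply minus_add.
Qed.

(** * The conditions on ranges and null spaces, in elementwise form *)

Lemma trivial_meet_iff :
  Same_set Y (Intersection Y (ran Tbar) (ker Tp)) (Singleton Y zero) <->
  (forall y, ran Tbar y -> ker Tp y -> y = zero).
Proof.
split.
- intros [h _] y hy hk; assert (hs : Singleton Y zero y) by now apply h.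
  now destruct hs.
- intros h; split; intros y hy.
  + destruct hy as [y hy hk]; rewrite (h y hy hk); constructor.
  + destruct hy; constructor.
    * exists zero; split; [apply Tbar_linear | apply (linear_zero Tbar_linear)].
    * split; [apply gi_linear | apply (linear_zero gi_linear)].
Qed.

(** Put [y = J (Tbar n)]. Then [y - T (Tp y) = W y - Tbar (Tp y) = Tbar (n - Tp y)] lies both in
    [ran Tbar] and in [ker Tp], so it vanishes and [y = T (Tp y)]. *)
Lemma ran_of_trivial_meet :
  (forall y, ran Tbar y -> ker Tp y -> y = zero) ->
  forall x, ker T x -> ran T (J (Tbar x)).
Proof.
intros h n [hn hn0]; set (y := J (Tbar n)).
assert (hTn : dom Tp (Tbar n)).
{ apply ran_Tbar_sub; exists n; split; auto; now apply Tbar_dom. }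
assert (hy : dom Tp y) by now apply J_maps.
assert (hWy : W y = Tbar n) by now apply W_J.
exists (Tp y); split; [now apply gi_dom|].
symmetry; apply minus_zero_eq, h; [|now apply gi_compl_ker].
assert (hp := gi_dom _ hy).
exists (minus n (Tp y)); split.
- apply Tbar_dom; now apply (linear_dom_minus linT).
- rewrite (linear_minus Tbar_linear) by now apply Tbar_dom.
  rewrite <- hWy, W_decomp; apply add_minus.
Qed.

Lemma J_ran_sub :
  (forall x, ker T x -> ran T (J (Tbar x))) ->
  forall x, dom T x -> ran T (J (Tbar x)).
Proof.
intros h x hx; rewrite (J_Tbar_decomp _ hx).
destruct (h _ (gi_ker_compl _ hx)) as [u [hu eu]].
exists (plus u x); split; [now apply (linear_dom_plus linT)|].
now rewrite (linear_plus linT hu hx), eu.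
Qed.

(** [J] fixes [ker Tp], so an element [y] of the intersection equals [J y] and lies in [ran T]; then
    [y = T (Tp y) = T 0 = 0]. *)
Lemma trivial_meet_of_ran :
  (forall x, dom T x -> ran T (J (Tbar x))) ->
  forall y, ran Tbar y -> ker Tp y -> y = zero.
Proof.
intros h y [x [[hx _] <-]] hk.
assert (hr := h x hx); rewrite (J_ker _ hk) in hr.
destruct (gi_ran _ hr) as [_ <-], hk as [_ ->].
apply (linear_zero linT).
Qed.

(** Only one inclusion is a condition: any [y] in [ran T] is [J (W y)] with [W y = Tbar (Tp y)]. *)
Lemma image_J_iff :
  Same_set Y (op_image J (ran Tbar)) (ran T) <->
  (forall x, dom T x -> ran T (J (Tbar x))).
Proof.
split.
- intros [h _] x hx; apply h.
  assert (hr : ran Tbar (Tbar x)) by (exists x; split; auto; now apply Tbar_dom).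
  exists (Tbar x); split; [now apply J_dom, ran_Tbar_sub | now split].
- intros h; split; intros y hy.
  + destruct hy as [z [_ [[x [[hx _] <-]] <-]]]; now apply h.
  + destruct (gi_ran _ hy) as [hd _]; exists (W y); split; [|split].
    * now apply J_dom, hW.
    * rewrite <- (Tbar_Tp_ran _ hy); exists (Tp y); split; auto.
      now apply Tbar_dom, gi_dom.
    * now apply J_W.
Qed.

Lemma J_Tbar_maps_iff :
  op_maps (op_comp J Tbar) (ker T) (ran T) <->
  (forall x, ker T x -> ran T (J (Tbar x))).
Proof.
split; intros h x hx; [now apply h|].
assert (hd : dom Tbar x) by now apply Tbar_dom, hx.
split; [split; auto | now apply h].
apply J_dom, ran_Tbar_sub; now exists x.
Qed.

Lemma image_J'_iff :
  Same_set X (op_image J' (ker T)) (ker Tbar) <->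
  (forall y, ran Tbar y -> ker Tp y -> y = zero).
Proof.
split.
(* If [Tp (Tbar x) = 0] then [V x] lies in [ker T], so [x = J' (V x)] belongs to the image and hence
   to [ker Tbar]. *)
- intros [h _] y [x [hd <-]] [_ hk].
  assert (hx := proj1 (Tbar_dom x) hd).
  apply (h x); exists (V x); split; [|split].
  + exists x; split; [now apply V_dom | reflexivity].
  + rewrite (V_eq_compl _ hx hk); now apply gi_ker_compl.
  + now apply (bijective_inv_l V_bijective).
- intros h; split; [|exact ker_Tbar_sub].
  (* From [V u = n] and [T n = 0] comes [T u = - T (Tp (dT u))]. So [Tbar u = dT u - T (Tp (dT u))]
     lies in [ker Tp], and the trivial intersection kills it. *)
  intros x [n [_ [[hn hn0] <-]]]; set (u := J' n).
  assert (hu : dom T u) by exact (bijective_inv_dom V_bijective _ hn).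
  assert (hVu : plus u (Tp (dT u)) = n) by exact (bijective_inv_r V_bijective _ hn).
  assert (hD := delta_dom _ hu).
  split; [now apply Tbar_dom|].
  apply h; [exists u; split; auto; now apply Tbar_dom|].
  replace (Tbar u) with (minus (dT u) (T (Tp (dT u)))).
  2: { assert (hw := gi_dom _ hD).
       assert (hT : plus (T u) (T (Tp (dT u))) = zero)
         by now rewrite <- (linear_plus linT), hVu.
       simpl; rewrite <- (add_minus (T u) (T (Tp (dT u)))), hT.
       rewrite plus_comm; apply (f_equal (plus (dT u))).
       symmetry; exact (plus_zero_l _). }
  now apply gi_compl_ker.
Qed.

(** * The operator [G] as a generalized inverse *)

Lemma G_dom (y : Y) : dom G y <-> dom Tp y.
Proof.
split; [intros [hy _]; now apply J_dom|].
intros hy; split; [now apply J_dom | now apply J_maps].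
Qed.

Lemma G_densely_defined : densely_defined_op G.
Proof.
split; [apply linear_op_comp; [apply J_linear | apply gi_linear]|].
intros y U hU; destruct (proj2 (proj1 hTp) y U hU) as [z [hz hd]].
exists z; split; auto; now apply G_dom.
Qed.

Lemma ran_G : Same_set X (ran G) (ran Tp).
Proof.
split; intros x [y [hy <-]].
- apply G_dom in hy; exists (J y); split; [now apply J_maps | reflexivity].
- exists (W y); split; [now apply G_dom, hW|].
  exact (f_equal Tp (J_W _ hy)).
Qed.

(** If [Tp (J y) = 0] then [W] fixes [J y], whence [y = J y]. *)
Lemma ker_G : Same_set Y (ker G) (ker Tp).
Proof.
split; intros y hy.
- destruct hy as [hy h]; apply G_dom in hy.
  assert (hk : ker Tp (J y)) by (split; auto; now apply J_maps).
  now rewrite <- (W_J _ hy), (W_ker _ hk).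
- split; [now apply G_dom, hy|].
  exact (eq_trans (f_equal Tp (J_ker _ hy)) (proj2 hy)).
Qed.

(** With [z = J y], [Tbar (Tp z) = W z - (z - T (Tp z))]. Applying [J] gives [z - (z - T (Tp z))],
    and [Tp] annihilates the bracket. *)
Lemma G_Tbar_G (y : Y) : dom Tp y -> G (Tbar (G y)) = G y.
Proof.
intros hy; change (Tp (J (Tbar (Tp (J y)))) = Tp (J y)).
assert (hz := J_maps _ hy); set (z := J y) in *.
assert (hk := gi_compl_ker _ hz).
rewrite <- (add_minus_l (minus z (T (Tp z))) (Tbar (Tp z))), <- W_decomp.
assert (hWz : dom Tp (W z)) by now apply hW.
rewrite (linear_minus J_linear) by (apply J_dom; auto; apply hk).
rewrite (J_W _ hz), (J_ker _ hk), (linear_minus gi_linear) by (auto; apply hk).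
rewrite (proj2 hk); exact (minus_zero_r _).
Qed.

(** For [y = J (Tbar x)] the equation reads [Tbar (Tp y) = W y], which characterizes [ran T] within
    [dom Tp]. *)
Lemma Tbar_G_Tbar_iff (x : X) : dom T x ->
  Tbar (G (Tbar x)) = Tbar x <-> ran T (J (Tbar x)).
Proof.
intros hx; change (Tbar (Tp (J (Tbar x))) = Tbar x <-> ran T (J (Tbar x))).
assert (hT : dom Tp (Tbar x)).
{ apply ran_Tbar_sub; exists x; split; auto; now apply Tbar_dom. }
split; intros h.
- apply ran_of_Tbar_Tp; [now apply J_maps|].
  now rewrite (W_J _ hT).
- now rewrite (Tbar_Tp_ran _ h), W_J.
Qed.

Lemma generalized_inverse_iff :
  generalized_inverse Tbar G <-> (forall x, dom T x -> ran T (J (Tbar x))).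
Proof.
split.
- intros [_ [_ [_ [h _]]]] x hx; apply Tbar_G_Tbar_iff; auto.
  now apply h, Tbar_dom.
- intros h; split; [exact G_densely_defined|split; [|split; [|split]]].
  + intros y hy; now apply G_dom, ran_Tbar_sub.
  + intros x hx; apply ran_G in hx; destruct hx as [y [hy <-]].
    now apply Tbar_dom, gi_dom.
  + intros x hx; apply Tbar_dom in hx; apply Tbar_G_Tbar_iff; auto.
  + intros y hy; now apply G_Tbar_G, G_dom.
Qed.

(** The identity is [y = W (J y)] rearranged; it turns a limit of [dT (G y)] into a limit of
    [J y]. *)
Lemma graph_G (y : Y) : dom G y ->
  dom Tp (J y) /\ dom T (G y) /\ minus y (dT (G y)) = J y.
Proof.
intros hy; apply G_dom in hy.
assert (hJ : dom Tp (J y)) by exact (J_maps _ hy).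
split; [assumption | split; [exact (gi_dom _ hJ)|]].
rewrite <- (W_J _ hy) at 1; exact (add_minus (J y) _).
Qed.

(** Let [u = G y' - G y = Tp (J y' - J y)]. The relative bound gives [a * norm u] plus at most
    [b * c * norm (J y' - J y)], and [J y' - J y = (y' - y) - dT u]; the resulting [dT u] term is
    moved to the left. *)
Lemma delta_G_bound (a b c : R) (hb0 : 0 < b)
    (hbound : forall x, dom T x -> norm (dT x) <= a * norm x + b * norm (T x))
    (hc0 : 0 <= c) (hc : forall y, dom Tp y -> norm (T (Tp y)) <= c * norm y)
    (y y' : Y) : dom G y -> dom G y' ->
  (1 - b * c) * norm (minus (dT (G y')) (dT (G y))) <=
  a * norm (minus (G y') (G y)) + b * c * norm (minus y' y).
Proof.
intros hy hy'.
destruct (graph_G _ hy) as (dJ & dG & e), (graph_G _ hy') as (dJ' & dG' & e').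
assert (linP := gi_linear).
assert (hu := linear_dom_minus linT dG' dG).
assert (hz := linear_dom_minus linP dJ' dJ).
assert (h1 := hbound _ hu).
rewrite (linear_minus linD) in h1 by now apply hdom.
assert (h2 := hc _ hz).
rewrite (linear_minus linP dJ' dJ) in h2.
change (norm (T (minus (G y') (G y))) <= c * norm (minus (J y') (J y))) in h2.
assert (h3 : norm (minus (J y') (J y)) <=
  norm (minus y' y) + norm (minus (dT (G y')) (dT (G y)))).
{ rewrite <- e, <- e', minus_minus_minus.
  eapply Rle_trans; [exact (norm_triangle _ (opp _))|].
  apply Rplus_le_compat_l, Req_le; exact (norm_opp _). }
assert (h4 : b * norm (T (minus (G y') (G y))) <=
  b * (c * (norm (minus y' y) + norm (minus (dT (G y')) (dT (G y)))))).
{ apply Rmult_le_compat_l; [lra|]; eapply Rle_trans; [exact h2|].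
  now apply Rmult_le_compat_l. }
lra.
Qed.

End PerturbedInverse.

(** * Closedness of [G] *)

Section ClosedGeneralizedInverse.

Context {K : AbsRing} {X : NormedModule K} {Y : CompleteNormedModule K}.
Context {T dT : op X Y} {Tp : op Y X}.

Hypothesis linT : linear_op T.
Hypothesis hTp : generalized_inverse T Tp.
Hypothesis hdom : Included X (dom T) (dom dT).

Notation W := (op_add (op_id Y) (op_comp dT Tp)).
Notation J := (op_inv W).
Notation G := (op_comp Tp J).

Hypothesis hW : op_bijective W (dom Tp) (dom Tp).

Lemma closed_G (a b c : R) (ha : 0 < a) (hb0 : 0 < b)
    (hbound : forall x, dom T x -> norm (dT x) <= a * norm x + b * norm (T x))
    (hc0 : 0 <= c) (hc : forall y, dom Tp y -> norm (T (Tp y)) <= c * norm y)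
    (hbc : b * c < 1) :
  closed_op dT -> closed_op Tp -> closed_op G.
Proof.
intros [[linD _] clD] [_ clP].
split; [apply (G_densely_defined (T := T)); auto|].
(* [hcl] says that [(y, x)] is adherent to the graph [D]. The trace on [D] of its neighbourhood
   filter plays the role of a sequence, and adherence makes this filter proper. *)
intros [y x] hcl; set (D := fun p : Y * X => dom G (fst p) /\ G (fst p) = snd p) in *.
set (F := within D (locally (y, x))).
assert (FF : ProperFilter F).
{ constructor.
  - intros P HP; apply NNPP; intros hn; apply hcl; revert HP.
    apply (filter_imp (F := locally (y, x))); intros p hp hD; apply hn.
    exists p; now apply hp.
  - apply within_filter, locally_filter. }
assert (FD : F D) by (apply (filter_forall (F := locally (y, x))); auto).
assert (limY : filterlim fst F (locally y)).
{ intros P HP; generalize (continuous_fst y x P HP).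
  apply (filter_imp (F := locally (y, x))); intros p hp _; exact hp. }
assert (limX : filterlim snd F (locally x)).
{ intros P HP; generalize (continuous_snd y x P HP).
  apply (filter_imp (F := locally (y, x))); intros p hp _; exact hp. }
(* Completeness of [Y] yields the limit [w] from the Cauchy property. *)
assert (hw : exists w, filterlim (fun p => dT (snd p)) F (locally w)).
{ apply (filterlim_locally_cauchy (U := Y) (F := F) (fun p => dT (snd p))).
  intros eps.
  (* For two graph points within [e / 2] of [(y, x)], the right side of [delta_G_bound] is less than
     [M * e]. The radius [e] makes this [(1 - b * c) * eps], and [1 - b * c > 0] cancels. *)
  set (M := a * norm_factor (V := X) + b * c * norm_factor (V := Y)).
  assert (hbc0 : 0 <= b * c) by (apply Rmult_le_pos; lra).
  assert (hM : 0 < M).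
  { assert (hX := norm_factor_gt_0 (V := X)); assert (hY := norm_factor_gt_0 (V := Y)).
    apply Rplus_lt_le_0_compat; [now apply Rmult_lt_0_compat|].
    apply Rmult_le_pos; lra. }
  assert (he : 0 < (1 - b * c) * eps / M).
  { apply Rdiv_lt_0_compat; auto; apply Rmult_lt_0_compat; [lra | apply cond_pos]. }
  set (e := mkposreal _ he).
  exists (fun p => D p /\ ball y (e / 2) (fst p) /\ ball x (e / 2) (snd p)); split.
  - apply filter_and; [exact FD|]; apply filter_and.
    + apply limY; apply (locally_ball y (pos_div_2 e)).
    + apply limX; apply (locally_ball x (pos_div_2 e)).
  - intros [y1 x1] [y2 x2] [[d1 e1] [by1 bx1]] [[d2 e2] [by2 bx2]].
    cbn [fst snd] in *.
    subst x1 x2.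
    assert (nY := norm_minus_half_balls y y1 y2 e by1 by2).
    assert (nX := norm_minus_half_balls x _ _ e bx1 bx2).
    assert (hk := delta_G_bound linT linD hTp hdom hW a b c hb0 hbound hc0 hc y1 y2 d1 d2).
    apply (norm_compat1 (V := Y)).
    apply (Rmult_lt_reg_l (1 - b * c)); [lra|].
    eapply Rle_lt_trans; [exact hk|].
    assert (heM : M * e = (1 - b * c) * eps) by (simpl; field; lra).
    rewrite <- heM; unfold M; rewrite Rmult_plus_distr_r, !Rmult_assoc.
    apply Rplus_lt_le_compat; [now apply Rmult_lt_compat_l|].
    rewrite <- !(Rmult_assoc b c); apply Rmult_le_compat_l; lra. }
destruct hw as [w limD].
assert (limz : filterlim (fun p => J (fst p)) F (locally (minus y w))).
{ apply (filterlim_ext_loc (fun p : Y * X => minus (fst p) (dT (snd p)))).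
  - revert FD; apply filter_imp; intros p [hp <-].
    now apply (graph_G hTp hW).
  - refine (filterlim_comp_2 (fun p : Y * X => fst p) (fun p => opp (dT (snd p))) plus
      limY _ (filterlim_plus y (opp w))).
    exact (filterlim_comp _ _ _ _ _ _ _ _ limD (filterlim_opp w)). }
(* The pairs [(G y', dT (G y'))] stay in the closed graph of [dT] and tend to [(x, w)]. *)
assert (hxw : dom dT x /\ dT x = w).
{ apply (closed_filterlim_loc (F := F) (fun p => (snd p, dT (snd p)))
    (fun q => dom dT (fst q) /\ dT (fst q) = snd q) (x, w)); auto.
  - now apply filterlim_pair_locally.
  - revert FD; apply filter_imp; intros p [hp <-]; split; auto.
    apply hdom, (graph_G hTp hW), hp. }
(* Likewise the pairs [(J y', G y')] stay in the closed graph of [Tp] and tend to [(y - w, x)]. *)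
assert (hzx : dom Tp (minus y w) /\ Tp (minus y w) = x).
{ apply (closed_filterlim_loc (F := F) (fun p => (J (fst p), snd p))
    (fun q => dom Tp (fst q) /\ Tp (fst q) = snd q) (minus y w, x)); auto.
  - now apply filterlim_pair_locally.
  - revert FD; apply filter_imp; intros p [hp <-]; split; auto.
    now apply (graph_G hTp hW). }
destruct hxw as [hx ex], hzx as [hz ez].
assert (hWz : W (minus y w) = y).
{ simpl; rewrite ez, ex; exact (minus_add y w). }
assert (hJ : J y = minus y w).
{ exact (bijective_inv_unique hW _ _ hz hWz). }
split; [|exact (eq_trans (f_equal Tp hJ) ez)].
apply (G_dom hW); rewrite <- hWz; now apply hW.
Qed.

End ClosedGeneralizedInverse.

Theorem theorem3p3
  (K : AbsRing) (hK : K = R_AbsRing \/ K = C_AbsRing)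
  (X Y : CompleteNormedModule K)
  (T : op X Y) (hT : closed_op T)
  (Tp : op Y X) (hTp : generalized_inverse T Tp)
  (dT : op X Y) (hdT : linear_op dT)
  (hdT_ran : op_maps dT (dom dT) (dom Tp))
  (hdom : Included X (dom T) (dom dT))
  (a b : R) (hbound : relatively_bounded dT T a b) (hb : b < 1)
  (hbij : op_bijective (op_add (op_id Y) (op_comp dT Tp)) (dom Tp) (dom Tp)) :
  let Tbar := op_add T dT in
  let J := op_inv (op_add (op_id Y) (op_comp dT Tp)) in
  let J' := op_inv (op_restrict (op_add (op_id X) (op_comp Tp dT)) (dom T)) in
  let G := op_comp Tp J in
  let P1 := Same_set Y (Intersection Y (ran Tbar) (ker Tp)) (Singleton Y zero) in
  let P2 := generalized_inverse Tbar G /\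
            Same_set X (ran G) (ran Tp) /\ Same_set Y (ker G) (ker Tp) in
  let P3 := op_maps (op_comp J Tbar) (ker T) (ran T) in
  let P4 := Same_set Y (op_image J (ran Tbar)) (ran T) in
  let P5 := Same_set X (op_image J' (ker T)) (ker Tbar) in
  ((P1 <-> P2) /\ (P1 <-> P3) /\ (P1 <-> P4) /\ (P1 <-> P5))
  /\
  (closed_op dT -> closed_op Tp ->
   let c := op_sup (op_comp T Tp) in
   Rbar_lt c p_infty ->
   Rbar_lt (Rbar_mult b c) 1 ->
   closed_op G).
Proof.
intros Tbar J J' G P1 P2 P3 P4 P5.
destruct hT as [[linT denseT] clT].
destruct hbound as [_ [ha [hb0 hbd]]].
assert (e1 := trivial_meet_iff linT hdT hTp).
assert (e2 := generalized_inverse_iff hdT hTp hdT_ran hdom hbij).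
assert (e3 := J_Tbar_maps_iff hTp hdT_ran hdom hbij).
assert (e4 := image_J_iff hTp hdT_ran hdom hbij).
assert (e5 := image_J'_iff linT hdT hTp hdT_ran hdom hbij).
assert (i13 := ran_of_trivial_meet linT hdT hTp hdT_ran hdom hbij).
assert (i34 := J_ran_sub linT hdT hTp hdT_ran hdom hbij).
assert (i41 := trivial_meet_of_ran linT hdT hTp hbij).
assert (hG : Same_set X (ran G) (ran Tp) /\ Same_set Y (ker G) (ker Tp))
  by exact (conj (ran_G hbij) (ker_G hdT hbij)).
split.
(* The cycle [i13], [i34], [i41] joins the elementwise forms; [e1] to [e5] translate each condition
   into one of them. *)
- unfold P1, P2, P3, P4, P5; tauto.
- intros clD clP c hc hbc.
  assert (linTTp : linear_op (op_comp T Tp))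
    by exact (linear_op_comp (gi_linear hTp) linT).
  apply (closed_G linT hTp hdom hbij a b (Rmax 0 c)); auto.
  + apply Rmax_l.
  + intros y hy; apply (op_sup_bound hK linTTp hc).
    split; [exact hy | exact (gi_dom hTp _ hy)].
  + apply Rmax_case; [lra|].
    (* For [c = -oo], [real] returns 0 and the claim is [b * 0 < 1]. *)
    fold c in hc; destruct c as [r | |]; simpl in *; [exact hbc | easy | lra].
Qed.
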